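(* Let $\Sigma$ be a finite alphabet and let $L\subseteq\Sigma^*$ be a language. There exists a unique surjective linear isometry $$J_L:X_L\longrightarrow\overline{\operatorname{span}\{\pi_u^L:u\in\Sigma^*\}}^{\,C(K_L)}$$ such that $J_L\bigl(\mathbf 1_{u^{-1}L}\bigr)=\pi_u^L$ for every $u\in\Sigma^*$.
   Context: All Banach spaces are real. $\Sigma$ is a finite nonempty alphabet, $\Sigma^*$ the free monoid of finite words over $\Sigma$; for $u\in\Sigma^*$, $u^{-1}L=\{v\in\Sigma^*:uv\in L\}$, and $\mathbf 1_B$ is the characteristic function of $B$. $X_L=\overline{\operatorname{span}}\{\mathbf 1_{u^{-1}L}:u\in\Sigma^*\}\subset\ell_\infty(\Sigma^* )$, closure in the supremum norm. $\Omega_\Sigma=\{0,1\}^{\Sigma^*}$ carries the product topology ($\{0,1\}$ discrete). For $v\in\Sigma^*$, $\rho_v:\Omega_\Sigma\to\Omega_\Sigma$ is given by $(\rho_vx)(u)=x(uv)$ for $u\in\Sigma^*$. For $u\in\Sigma^*$, $\pi_u:\Omega_\Sigma\to\mathbb R$, $\pi_u(x)=x(u)$. Put $x_L=\mathbf 1_L\in\Omega_\Sigma$, $K_L=\overline{\{\rho_vx_L:v\in\Sigma^*\}}\subseteq\Omega_\Sigma$ (a compact set), and $\pi_u^L=\pi_u|_{K_L}$. $C(K_L)$ is the Banach space of continuous real functions on $K_L$ with the supremum norm. *)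

(* Defs.v *)
From HB Require Import structures.
From mathcomp Require Import all_boot all_order all_algebra.
From mathcomp Require Import all_classical all_reals all_analysis.

Set Implicit Arguments.
Unset Strict Implicit.
Unset Printing Implicit Defensive.

Import Order.TTheory GRing.Theory Num.Theory.
Import numFieldNormedType.Exports.

Local Open Scope classical_set_scope.
Local Open Scope ring_scope.

Section span.
Context {R : realType} {V : normedModType R}.
Implicit Types S : set V.

Definition lin_span S : set V :=
  [set v | exists n (c : 'I_n -> R) (s : 'I_n -> V),
     (forall i, S (s i)) /\ v = \sum_(i < n) c i *: s i].

Lemma sub_lin_span S : S `<=` lin_span S.
Proof.
move=> v Sv; exists 1%N, (fun=> 1), (fun=> v); split=> //.
by rewrite big_ord1 scale1r.
Qed.

Lemma lin_span0 S : lin_span S 0.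
Proof.
exists 0%N, (fun=> 0), (fun=> 0); split; last by rewrite big_ord0.
by case.
Qed.

Lemma lin_span_lin S a v w :
  lin_span S v -> lin_span S w -> lin_span S (a *: v + w).
Proof.
move=> [m [c [s [Ss ->]]]] [n [d [t [St ->]]]].
exists (m + n)%N.
exists (fun i => match fintype.split i with inl j => a * c j | inr k => d k end).
exists (fun i => match fintype.split i with inl j => s j | inr k => t k end).
split=> [i|]; first by case: (fintype.split i).
rewrite big_split_ord scaler_sumr /=; congr (_ + _); apply: eq_bigr => i _.
- by rewrite (unsplitK (inl i)) scalerA.
- by rewrite (unsplitK (inr i)).
Qed.

Lemma closure_normP (A : set V) v :
  closure A v <-> forall e, 0 < e -> exists2 w, A w & `|v - w| < e.
Proof.
split=> [clA e e0|H B].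
  have [w [Aw Bw]] := clA _ (nbhsx_ballx v e e0).
  by exists w => //; move: Bw; rewrite -ball_normE.
move=> /nbhs_ballP[e /= e0 eB]; have [w Aw vw] := H _ e0.
by exists w; split=> //; apply: eB; rewrite -ball_normE.
Qed.

Definition in_closed_span S : {pred V} := mem (closure (lin_span S)).

Lemma closed_span_submod S : submod_closed (in_closed_span S).
Proof.
split=> [|a v w]; first by apply/mem_set/subset_closure/lin_span0.
move=> /set_mem/closure_normP cv /set_mem/closure_normP cw.
apply/mem_set/closure_normP => e e0.
have a0 : 0 < `|a| + 1 by rewrite ltr_wpDl.
have [v' Sv' vv'] := cv (e / 2 / (`|a| + 1))
  (divr_gt0 (divr_gt0 e0 (ltr0Sn _ _)) a0).
have [w' Sw' ww'] := cw (e / 2) (divr_gt0 e0 (ltr0Sn _ _)).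
exists (a *: v' + w'); first exact: lin_span_lin.
rewrite opprD addrACA -scalerBr (le_lt_trans (ler_normD _ _))// [ltRHS]splitr.
rewrite ler_ltD// normrZ.
rewrite ltr_pdivlMr// in vv'.
rewrite (le_trans _ (ltW vv'))// mulrC ler_wpM2l//.
by rewrite lerDl.
Qed.

HB.instance Definition _ S :=
  GRing.isSubmodClosed.Build _ _ (in_closed_span S) (closed_span_submod S).

Record closed_span S := ClosedSpan {
  closed_span_val :> V;
  closed_spanP : closed_span_val \in in_closed_span S }.

HB.instance Definition _ S := [isSub for @closed_span_val S].
HB.instance Definition _ S := [Choice of closed_span S by <:].
HB.instance Definition _ S := [SubChoice_isSubLmodule of closed_span S by <:].

End span.

Section closed_span_norm.
Context {R : realType} {V : normedModType R} (S : set V).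
Implicit Types v w : closed_span S.

Let nrm v : R := `|val v|.

Let nrmD v w : nrm (v + w) <= nrm v + nrm w.
Proof. exact: ler_normD. Qed.

Let nrmZ (a : R) v : nrm (a *: v) = `|a| * nrm v.
Proof. exact: normrZ. Qed.

Let nrm0_eq0 v : nrm v = 0 -> v = 0.
Proof. by move=> /normr0_eq0 v0; apply: val_inj. Qed.

HB.instance Definition _ :=
  Lmodule_isNormed.Build R (closed_span S) nrmD nrmZ nrm0_eq0.

Lemma closed_span_normE v : `|v| = `|val v|. Proof. by []. Qed.

End closed_span_norm.

Section closed_span_gen.
Context {R : realType} {V : normedModType R} {I : Type} (s : I -> V).

Fact closed_span_gen_subproof i : s i \in in_closed_span (range s).
Proof. by apply/mem_set/subset_closure/sub_lin_span; exists i. Qed.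

Definition closed_span_gen i : closed_span (range s) :=
  ClosedSpan (closed_span_gen_subproof i).

End closed_span_gen.

Section supnorm.
Context {R : realType} {T : Type}.
Implicit Types f g : T -> R.

(* When T is empty this is the supremum of the empty set, which is 0. *)
Definition supnorm f : R := sup (range (fun x => `|f x|)).

Lemma bounded_funP f : bounded_fun f <-> exists M, forall x, `|f x| <= M.
Proof.
split=> [[M [_ fM]]|[M fM]].
  by exists (M + 1) => x; apply: fM => //; rewrite ltrDl.
exists M; split=> [|N MN x _]; first exact: num_real.
exact: le_trans (fM x) (ltW MN).
Qed.

Lemma supnorm_ub f x : bounded_fun f -> `|f x| <= supnorm f.
Proof.
move=> /bounded_funP[M fM]; apply: ub_le_sup; last by exists x.
by exists M => _ [y _ <-].
Qed.

Lemma supnorm_le f M : 0 <= M -> (forall x, `|f x| <= M) -> supnorm f <= M.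
Proof.
move=> M0 fM; rewrite /supnorm; set A := (X in sup X).
have [->|/set0P A0] := eqVneq A set0; first by rewrite sup0.
by apply: ge_sup => // _ [x _ <-].
Qed.

Lemma supnorm_ge0 f : 0 <= supnorm f.
Proof.
have [fM|nf] := pselect (has_sup (range (fun x => `|f x|))); last first.
  by rewrite /supnorm sup_out.
have [[_ [x _ _]] ubf] := fM.
by rewrite (le_trans (normr_ge0 (f x)))//; apply: ub_le_sup => //; exists x.
Qed.

Lemma supnorm0 : supnorm 0 = 0.
Proof.
by apply/eqP; rewrite eq_le supnorm_ge0 supnorm_le// => x; rewrite normr0.
Qed.

Lemma bounded_fun0 : bounded_fun (0 : T -> R).
Proof. by apply/bounded_funP; exists 0 => x; rewrite normr0. Qed.

Lemma bounded_fun_lin (a : R) f g :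
  bounded_fun f -> bounded_fun g -> bounded_fun (a *: f + g).
Proof.
move=> /bounded_funP[M fM] /bounded_funP[N gN]; apply/bounded_funP.
exists (`|a| * M + N) => x; rewrite (le_trans (ler_normD _ _))// lerD//.
by rewrite normrM ler_wpM2l.
Qed.

Lemma supnormD f g : bounded_fun f -> bounded_fun g ->
  supnorm (f + g) <= supnorm f + supnorm g.
Proof.
move=> bf bg; apply: supnorm_le => [|x]; first by rewrite addr_ge0 ?supnorm_ge0.
by rewrite (le_trans (ler_normD _ _))// lerD ?supnorm_ub.
Qed.

Lemma supnormZ (a : R) f : bounded_fun f ->
  supnorm (a *: f) = `|a| * supnorm f.
Proof.
move=> bf; have le_supZ (b : R) g : bounded_fun g ->
    supnorm (b *: g) <= `|b| * supnorm g.
  move=> bg; apply: supnorm_le => [|x]; first by rewrite mulr_ge0 ?supnorm_ge0.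
  by rewrite normrM ler_wpM2l ?supnorm_ub.
have [->|a0] := eqVneq a 0; first by rewrite scale0r supnorm0 normr0 mul0r.
apply/eqP; rewrite eq_le le_supZ//= -ler_pdivlMl ?normr_gt0//.
rewrite -normfV -{1}[f]scale1r -(mulVf a0) -scalerA le_supZ//.
by rewrite -[_ *: f]addr0; apply: bounded_fun_lin => //; exact: bounded_fun0.
Qed.

Lemma supnorm_eq0 f : bounded_fun f -> supnorm f = 0 -> f = 0.
Proof.
move=> bf f0; apply/funext => x; apply/normr0_eq0/eqP.
by rewrite eq_le normr_ge0 -f0 supnorm_ub.
Qed.

End supnorm.

Section linf.
Context {R : realType} {T : Type}.

Definition in_linf : {pred T -> R} := mem [set f : T -> R | bounded_fun f].

Lemma linf_submod : submod_closed in_linf.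
Proof.
split=> [|a f g /set_mem bf /set_mem bg]; apply/mem_set.
  exact: bounded_fun0.
exact: bounded_fun_lin.
Qed.

HB.instance Definition _ := GRing.isSubmodClosed.Build _ _ in_linf linf_submod.

Record linf := Linf { linf_fun :> T -> R; linfP : linf_fun \in in_linf }.

HB.instance Definition _ := [isSub for linf_fun].
HB.instance Definition _ := [Choice of linf by <:].
HB.instance Definition _ := [SubChoice_isSubLmodule of linf by <:].

Let bnd (f : linf) : bounded_fun f. Proof. exact: set_mem (linfP f). Qed.

Let nrm (f : linf) : R := supnorm f.

Let nrmD (f g : linf) : nrm (f + g) <= nrm f + nrm g.
Proof. exact: (supnormD (bnd f) (bnd g)). Qed.

Let nrmZ (a : R) (f : linf) : nrm (a *: f) = `|a| * nrm f.
Proof. exact: (supnormZ a (bnd f)). Qed.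

Let nrm0_eq0 (f : linf) : nrm f = 0 -> f = 0.
Proof. by move=> f0; apply/val_inj/(supnorm_eq0 (bnd f)). Qed.

HB.instance Definition _ := Lmodule_isNormed.Build R linf nrmD nrmZ nrm0_eq0.

Lemma linf_normE (f : linf) : `|f| = supnorm f. Proof. by []. Qed.

End linf.
Arguments linf R T : clear implicits.

Section contc.
Context {R : realType} {X : topologicalType}.

Definition in_contc : {pred X -> R} := mem [set f : X -> R | continuous f].

Lemma contc_submod : submod_closed in_contc.
Proof.
split=> [|a f g /set_mem cf /set_mem cg]; apply/mem_set => x.
  exact: cst_continuous.
by apply: continuousD; [apply: continuousM; [exact: cst_continuous|exact: cf]
                       |exact: cg].
Qed.

HB.instance Definition _ := GRing.isSubmodClosed.Build _ _
  in_contc contc_submod.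

(* The compactness proof is a parameter of the type because the supremum norm
   is a norm only on bounded functions. *)
Record contc (cX : compact [set: X]) :=
  Contc { contc_fun :> X -> R; contcP : contc_fun \in in_contc }.

Variable cX : compact [set: X].
Local Notation C := (contc cX).

HB.instance Definition _ := [isSub for @contc_fun cX].
HB.instance Definition _ := [Choice of C by <:].
HB.instance Definition _ := [SubChoice_isSubLmodule of C by <:].

Let bnd (f : C) : bounded_fun f.
Proof.
have cf : continuous f := set_mem (contcP f).
have /compact_bounded[M [_ fM]] : compact (range f).
  by apply: continuous_compact => //; exact: continuous_subspaceT.
apply/bounded_funP; exists (M + 1) => x.
by apply: (fM (M + 1)); [rewrite ltrDl|exists x].
Qed.

Let nrm (f : C) : R := supnorm f.

Let nrmD (f g : C) : nrm (f + g) <= nrm f + nrm g.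
Proof. exact: (supnormD (bnd f) (bnd g)). Qed.

Let nrmZ (a : R) (f : C) : nrm (a *: f) = `|a| * nrm f.
Proof. exact: (supnormZ a (bnd f)). Qed.

Let nrm0_eq0 (f : C) : nrm f = 0 -> f = 0.
Proof. by move=> f0; apply/val_inj/(supnorm_eq0 (bnd f)). Qed.

HB.instance Definition _ := Lmodule_isNormed.Build R C nrmD nrmZ nrm0_eq0.

Lemma contc_normE (f : C) : `|f| = supnorm f. Proof. by []. Qed.

End contc.
Arguments contc R {X} cX.

Lemma compact_set_type (X : topologicalType) (A : set X) :
  compact A -> compact [set: A].
Proof.
move=> cA F PF _; have FA : (@set_val _ A @ F) A.
  by apply: (@filterS _ F _ setT); [move=> x _; exact: set_valP|exact: filterT].
have [x [Ax Fx]] := cA _ (fmap_proper_filter set_val PF) FA.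
exists (exist _ x (mem_set Ax)); split=> // B C FB.
rewrite nbhsE => -[_ [[W oW <-] Wx] WC].
have FB' : (@set_val _ A @ F) (set_val @` B).
  by apply: (@filterS _ F _ B) => // y By; exists y.
have [_ [[y By <-] Wy]] := Fx _ _ FB' (open_nbhs_nbhs (conj oW Wx)).
by exists y; split=> //; exact: WC.
Qed.

Section language.
Context {Sigma : finType}.
Implicit Types (L : set (seq Sigma)) (u v : seq Sigma).

Definition left_quotient u L : set (seq Sigma) := [set v | L (u ++ v)].

(* [bool], with its discrete topology, plays the role of {0, 1}. *)
Definition Omega : Type := {ptws seq Sigma -> bool}.
HB.instance Definition _ := Topological.on Omega.

Definition rho v (x : Omega) : Omega := fun u => x (u ++ v).

Definition xpoint L : Omega := fun u => u \in L.

Definition KL L : set Omega := closure (range (fun v => rho v (xpoint L))).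

Lemma compact_Omega : compact [set: Omega].
Proof.
have := @tychonoff _ (fun _ : seq Sigma => _) _ (fun=> bool_compact).
by congr (compact _); rewrite eqEsubset.
Qed.

Lemma compact_KL L : compact [set: KL L].
Proof.
apply/compact_set_type/(subclosed_compact _ compact_Omega) => //.
exact: closed_closure.
Qed.

End language.
Arguments Omega Sigma : clear implicits.
Arguments compact_KL {Sigma} L.

Section spaces.
Context {Sigma : finType} (R : realType) (L : set (seq Sigma)).
Implicit Types u v : seq Sigma.

Fact quot_indic_subproof u :
  (\1_(left_quotient u L) : seq Sigma -> R) \in in_linf.
Proof.
apply/mem_set/bounded_funP; exists 1 => v.
by rewrite indicE; case: (_ \in _); rewrite ?normr1 ?normr0.
Qed.

Definition quot_indic u : linf R (seq Sigma) := Linf (quot_indic_subproof u).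

Definition XL := closed_span (range quot_indic).

Definition XL_gen : seq Sigma -> XL := closed_span_gen quot_indic.

Definition pi_word u (x : Omega Sigma) : R := (x u)%:R.

Lemma pi_word_continuous u : continuous (pi_word u).
Proof.
have bc : continuous (fun b : bool => b%:R : R).
  move=> b A /nbhs_singleton Ab.
  suff : nbhs b [set c : bool | A c%:R] by [].
  by rewrite nbhs_principalE; exact/principal_filterP.
move=> x; apply: (@continuous_comp _ _ _ (fun y : Omega Sigma => y u)
  (fun b : bool => b%:R : R)); last exact: bc.
exact: (@proj_continuous _ (fun _ : seq Sigma => bool) u x).
Qed.

Fact pi_KL_subproof u : (fun x : KL L => pi_word u (val x)) \in in_contc.
Proof.
apply/mem_set => x.
apply: (@continuous_comp _ _ _ (@set_val _ (KL L)) (pi_word u)).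
  exact: initial_continuous.
exact: pi_word_continuous.
Qed.

Definition pi_KL u : contc R (compact_KL L) :=
  Contc (compact_KL L) (pi_KL_subproof u).

Definition YL := closed_span (range pi_KL).

Definition YL_gen : seq Sigma -> YL := closed_span_gen pi_KL.

End spaces.

(* Main.v *)
From HB Require Import structures.
Require Import Defs.
From mathcomp Require Import all_boot all_order all_algebra.
From mathcomp Require Import all_classical all_reals all_analysis lra.
Import Order.TTheory GRing.Theory Num.Theory.
Import numFieldNormedType.Exports.
Local Open Scope classical_set_scope.
Local Open Scope ring_scope.

(** The isometry is best seen from the side of K_L. A continuous function [h] on
    K_L can be restricted to the orbit of x_L, which gives the bounded function
    v |-> h (rho_v x_L) on words. This restriction map
    [restrict_orbit : C(K_L) -> l_oo] is linear, it preserves norms because the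
    orbit is dense in K_L ([dense_orbit], [norm_restrict_orbit]), and it sends
    pi_u to the indicator of u^-1 L, because the value of pi_u at rho_v x_L is
    x_L (uv) ([restrict_orbit_pi]).

    What remains is about normed spaces only. A linear isometry [T] from a
    complete space maps the closed span of a family [t] onto the closed span of
    the family [T \o t]: it commutes with finite linear combinations
    ([lin_span_image]) and, thanks to completeness, with closures
    ([closure_isometry_image]). Its inverse on that closed span is the isometry
    sought ([closed_span_isometry]). Here the complete space is C(K_L), which is
    why the completeness of [contc] is established first.

    Uniqueness holds because a linear isometry on a closed span is determined by
    its values on the generators ([closed_span_isometry_ext]). *)

Section contc_complete.
Context {R : realType} {X : topologicalType} {cX : compact [set: X]}.

Lemma contc_bounded (f : contc R cX) : bounded_fun f.
Proof.
have f_cont : continuous f := set_mem (contcP f).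
have /compact_bounded[M [Mreal fM]] : compact (range f).
  by apply: continuous_compact => //; exact: continuous_subspaceT.
by exists M; split=> // N MN x _; apply: fM MN _ _; exists x.
Qed.

Lemma ler_norm_contc (f : contc R cX) x : `|f x| <= `|f|.
Proof. exact: supnorm_ub (contc_bounded f). Qed.

(** The norm of [contc R cX] is the supremum norm, so this is the completeness
    of C(X): a Cauchy filter converges at each point by completeness of the
    reals, the pointwise limit is uniform because the Cauchy condition is, and
    a uniform limit of continuous functions is continuous by the usual
    argument with three errors e / 3. *)
Let contc_cauchy_cvg (F : set_system (contc R cX)) :
  ProperFilter F -> cauchy F -> cvg F.
Proof.
move=> PF /cauchy_ballP F_cauchy.
have F_pair (e : R) : 0 < e -> \forall f & g \near F,
    forall x, `|(f : contc R cX) x - (g : contc R cX) x| <= e.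
  move=> e0; apply: filterS (F_cauchy e e0) => -[f g] /=.
  rewrite -ball_normE /= => fg x.
  exact: le_trans (ler_norm_contc (f - g) x) (ltW fg).
have cvg_eval x : cvg ((f : contc R cX) x @[f --> F]).
  apply: cauchy_cvg; apply/cauchyP => e e0.
  have e20 : 0 < e / 2 by rewrite divr_gt0.
  have /nearP_dep/filter_ex[f fg] := F_pair _ e20.
  exists (f x); apply: filterS fg => g fg; rewrite -ball_normE /=.
  by apply: le_lt_trans (fg x) _; rewrite ltr_pdivrMr// ltr_pMr// ltr1n.
pose h x := lim ((f : contc R cX) x @[f --> F]).
have F_lim (e : R) : 0 < e -> \forall f \near F,
    forall x, `|h x - (f : contc R cX) x| <= e.
  move=> e0; have /nearP_dep := F_pair e e0.
  apply: filterS => f fg x.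
  have : (fun g : contc R cX => `|g x - f x|) @ F --> `|h x - f x|.
    by apply: cvg_norm; apply: cvgB; [exact: cvg_eval|exact: cvg_cst].
  apply: (closed_cvg (fun y : R => y <= e)); first exact: closed_le.
  by apply: filterS fg => g; rewrite distrC.
have h_cont : continuous h.
  move=> x; apply/cvgrPdist_le => e e0.
  have e30 : 0 < e / 3 by rewrite divr_gt0.
  have [f hf] := filter_ex (F_lim _ e30).
  have /(_ x)/cvgrPdist_le/(_ _ e30) : continuous f := set_mem (contcP f).
  apply: filterS => y fxy; have := hf x; have := hf y.
  move: fxy; rewrite !ler_norml; lra.
apply/cvg_ex; exists (Contc cX (mem_set h_cont : h \in in_contc)).
apply/(cvgrPdist_le id) => e e0.
apply: filterS (F_lim e e0) => f hf; exact: supnorm_le (ltW e0) hf.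
Qed.

HB.instance Definition _ := Uniform_isComplete.Build (contc R cX)
  contc_cauchy_cvg.

End contc_complete.

Section span_isometry.
Context {R : realType} {V : normedModType R} {W : completeNormedModType R}.
Variable T : {linear W -> V}.
Hypothesis norm_T : forall w, `|T w| = `|w|.

Lemma linear_isometry_inj : injective T.
Proof.
move=> w w' /eqP; rewrite -subr_eq0 -linearB -normr_eq0 norm_T normr_eq0.
by rewrite subr_eq0 => /eqP.
Qed.

Lemma lin_span_image (S : set W) : lin_span (T @` S) = T @` lin_span S.
Proof.
apply/seteqP; split=> [_ [n [c [s [Ss ->]]]]|_ [_ [n [c [s [Ss ->]]]] <-]].
  have [t tP] := choice (fun i => let: ex_intro2 w Sw Tw := Ss i in
    ex_intro (fun w => S w /\ T w = s i) w (conj Sw Tw)).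
  exists (\sum_i c i *: t i).
    by exists n, c, t; split=> // i; have [] := tP i.
  by rewrite linear_sum; apply: eq_bigr => i _; rewrite linearZ (tP i).2.
exists n, c, (T \o s); split=> [i|]; first by exists (s i).
by rewrite linear_sum; apply: eq_bigr => i _; rewrite linearZ.
Qed.

(** The inclusion from right to left is the continuity of [T]. For the other
    one, if [T w_n] converges to [v] then [w_n] is Cauchy, since [T] preserves
    distances, and by completeness of [W] it has a limit, which [T] maps to
    [v]. *)
Lemma closure_isometry_image (A : set W) : closure (T @` A) = T @` closure A.
Proof.
apply/seteqP; split=> [v /closure_normP clv|_ [w /closure_normP clw <-]].
  have approx n : exists w, A w /\ `|v - T w| < n.+1%:R^-1.
    by have [_ [w Aw <-] vw] := clv n.+1%:R^-1 ltac:(by []); exists w.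
  have [w_ w_P] := choice approx.
  have Tw_cvg : T (w_ n) @[n --> \oo] --> v.
    apply/cvgrPdist_lt => e e0.
    near=> n; apply: lt_trans (w_P n).2 _; near: n.
    exact: near_infty_natSinv_lt (PosNum e0).
  have w_cvg : cvg (w_ n @[n --> \oo]).
    apply: cauchy_cvg; apply/cauchyP => e e0.
    have e20 : 0 < e / 2 by rewrite divr_gt0.
    have near_v : \forall n \near \oo, `|v - T (w_ n)| < e / 2.
      by move/cvgrPdist_lt: Tw_cvg; apply.
    have [N vN] := filter_ex near_v.
    exists (w_ N); apply: filterS near_v => n vn.
    rewrite -ball_normE /= -norm_T linearB (le_lt_trans (ler_distD v _ _))//.
    by rewrite [ltRHS]splitr ltrD// distrC.
  exists (lim (w_ n @[n --> \oo])).
    apply: (closed_cvg _ (@closed_closure _ A) _ _ w_cvg).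
    by near=> n; apply: subset_closure; exact: (w_P n).1.
  apply: (cvg_unique _ _ Tw_cvg) => //.
  apply/cvgrPdist_lt => e e0; move/cvgrPdist_lt/(_ _ e0): w_cvg.
  by apply: filterS => n; rewrite -linearB norm_T.
apply/closure_normP => e e0; have [w' Aw' ww'] := clw e e0.
by exists (T w'); [exists w'|rewrite -linearB norm_T].
Unshelve. all: by end_near. Qed.

(** By the previous lemmas, [T] maps the closed span of the [t i] bijectively
    onto the closed span of the [s i]; [J] is the inverse of this map. *)
Lemma closed_span_isometry {I : Type} (s : I -> V) (t : I -> W) :
  (forall i, T (t i) = s i) ->
  exists J : closed_span (range s) -> closed_span (range t),
    [/\ linear J,
        forall f g, `|J f - J g| = `|f - g|,
        forall h, exists f, J f = h
      & forall i, J (closed_span_gen s i) = closed_span_gen t i].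
Proof.
move=> Tt.
have closE : closure (lin_span (range s)) = T @` closure (lin_span (range t)).
  rewrite -closure_isometry_image -lin_span_image image_comp.
  by congr (closure (lin_span _)); apply: eq_imagel => i _; rewrite /= Tt.
have T_surj (f : closed_span (range s)) :
    exists h : closed_span (range t), T (val h) = val f.
  have /set_mem := closed_spanP f; rewrite closE => -[w /mem_set wP Tw].
  by exists (ClosedSpan wP).
have [J TJ] := choice T_surj.
have J_eq f h : T (val h) = val f -> J f = h.
  by move=> Th; apply/val_inj/linear_isometry_inj; rewrite TJ.
exists J; split=> [a f g|f g|h|i].
- by apply: J_eq; rewrite !linearP /= !TJ.
- by rewrite !closed_span_normE -norm_T !linearB /= !TJ.
- have hP : T (val h) \in in_closed_span (range s).
    apply/mem_set; rewrite closE; exists (val h) => //.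
    exact: set_mem (closed_spanP h).
  by exists (ClosedSpan hP); exact: J_eq.
- by apply: J_eq; exact: Tt.
Qed.

End span_isometry.

Section closed_span_ext.
Context {R : realType} {V W : normedModType R} {I : Type} (s : I -> V).

(** A version of the definition of the closed span in which the approximating
    combination lives in the closed span itself, so that linear maps defined
    only there can be applied to it. *)
Lemma dense_lin_span_gen (v : closed_span (range s)) e : 0 < e ->
  exists n (c : 'I_n -> R) (i : 'I_n -> I),
    `|v - \sum_k c k *: closed_span_gen s (i k)| < e.
Proof.
move=> e0; have /set_mem/closure_normP/(_ e e0) := closed_spanP v.
case=> _ [n [c [w [ws ->]]]] vw.
have [i iw] := choice (fun k => let: ex_intro2 i _ si := ws k in
  ex_intro (fun i => s i = w k) i si).
exists n, c, i; rewrite closed_span_normE linearB linear_sum /=.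
by under eq_bigr => k _ do rewrite iw.
Qed.

(** Two linear isometries that agree on the generators agree on all finite
    combinations [w]; at [v] they then differ by at most twice the distance
    from [v] to [w], which can be taken arbitrarily small. *)
Lemma closed_span_isometry_ext (f g : closed_span (range s) -> W) :
    linear f -> (forall v w, `|f v - f w| = `|v - w|) ->
    linear g -> (forall v w, `|g v - g w| = `|v - w|) ->
  (forall i, f (closed_span_gen s i) = g (closed_span_gen s i)) -> f = g.
Proof.
move=> lf isof lg isog fg; apply/funext => v; apply/eqP.
pose F := HB.pack_for {linear _ -> _} f (GRing.isLinear.Build _ _ _ _ f lf).
pose G := HB.pack_for {linear _ -> _} g (GRing.isLinear.Build _ _ _ _ g lg).
rewrite -subr_eq0 -normr_le0; apply/ler_addgt0Pl => e e0; rewrite addr0.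
have [|n [c [i vw]]] := dense_lin_span_gen v (e / 2).
  by rewrite divr_gt0.
set w := (X in v - X) in vw.
have fgw : f w = g w.
  rewrite -[f]/(F : _ -> _) -[g]/(G : _ -> _) !linear_sum.
  by apply: eq_bigr => k _; rewrite !linearZ /= fg.
rewrite (le_trans (ler_distD (f w) _ _))// {2}fgw isof isog (distrC w).
by rewrite [leRHS]splitr lerD// ltW.
Qed.

End closed_span_ext.

Section orbit.
Context {Sigma : finType} (R : realType) (L : set (seq Sigma)).

Definition orbit_point (v : seq Sigma) : KL L :=
  exist _ (rho v (xpoint L)) (mem_set (subset_closure (imageT _ v))).

Lemma dense_orbit : closure (range orbit_point) = [set: KL L].
Proof.
apply/seteqP; split=> // x _ B; rewrite nbhsE => -[_ [[U U_open <-] Ux] UB].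
have [_ [[v _ <-] Uv]] := set_mem (valP x) _ (open_nbhs_nbhs (conj U_open Ux)).
by exists (orbit_point v); split; [exists v|exact: UB].
Qed.

Definition orbit_fun (h : contc R (compact_KL L)) (v : seq Sigma) : R :=
  h (orbit_point v).

Fact orbit_fun_bounded h : orbit_fun h \in in_linf.
Proof.
apply/mem_set/Defs.bounded_funP.
by exists `|h| => v; exact: ler_norm_contc.
Qed.

Definition restrict_orbit h : linf R (seq Sigma) := Linf (orbit_fun_bounded h).

Fact restrict_orbit_linear : linear restrict_orbit.
Proof. by move=> a h k; apply/val_inj. Qed.

HB.instance Definition _ :=
  GRing.isLinear.Build _ _ _ _ restrict_orbit restrict_orbit_linear.

(** A continuous function has the same supremum on K_L as on the dense orbit:
    the set where [`|h x|] is at most the supremum over the orbit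
    is closed and contains the orbit. *)
Lemma norm_restrict_orbit h : `|restrict_orbit h| = `|h|.
Proof.
apply/le_anti/andP; split; rewrite [leLHS]/=.
  by apply: supnorm_le => // v; exact: ler_norm_contc.
have bnd_orbit : range orbit_point `<=` [set x | `|h x| <= `|restrict_orbit h|].
  by move=> _ [v _ <-]; exact: supnorm_ub (set_mem (orbit_fun_bounded h)).
apply: supnorm_le => // x.
have h_cont : continuous (fun x => `|h x|).
  have h_cont : continuous h := set_mem (contcP h).
  by move=> y; apply: continuous_comp; [exact: h_cont|exact: norm_continuous].
have : closure (range orbit_point) x by rewrite dense_orbit.
move=> /(closureS bnd_orbit).
apply: (preimage_closed (D := [set y : R | y <= `|restrict_orbit h|])).
  by move=> y _; exact: h_cont.
exact: closed_le.
Qed.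

(** Shifting x_L by [v] and evaluating at [u], or taking the quotient of [L] by
    [u] and evaluating at [v], both test whether [u ++ v] is in [L]. *)
Lemma restrict_orbit_pi u : restrict_orbit (pi_KL R L u) = quot_indic R L u.
Proof. by apply/val_inj/funext => v /=; rewrite indicE. Qed.

End orbit.

Theorem theorem7p2 (R : realType) (Sigma : finType)
    (Sigma_neq0 : (0 < #|Sigma|)%N) (L : set (seq Sigma)) :
  exists! J : XL R L -> YL R L,
    [/\ linear J,
        forall f g : XL R L, `|J f - J g| = `|f - g|,
        forall h : YL R L, exists f : XL R L, J f = h
      & forall u : seq Sigma, J (XL_gen R L u) = YL_gen R L u].
Proof.
have [J [J_lin J_iso J_surj J_gen]] :=
  closed_span_isometry (restrict_orbit R L) (@norm_restrict_orbit _ R L)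
  (quot_indic R L) (pi_KL R L) (restrict_orbit_pi R L).
exists J; split=> // J' [J'_lin J'_iso _ J'_gen].
apply: closed_span_isometry_ext => // u.
by rewrite J_gen J'_gen.
Qed.
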